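(* Let $\langle\mathbb{P}_\alpha,\dot{\mathbb{Q}}_\beta : \alpha\leq\gamma,\ \beta<\gamma\rangle$ be a forcing iteration such that $\mathbb{P}=\mathbb{P}_\gamma$ is separative, and let $\kappa$ be an ordinal. Then the iteration $\mathbb{P}$ is $\kappa$-final if and only if it is $\kappa$-pseudodistributive.
   Context: A notion of forcing is a partially ordered set with maximal element $\mathbb{1}$; $q\leq p$ means $q$ is stronger. It is separative if whenever $p'\nleq p$ there is $q\leq p'$ with $q\perp p$ (i.e. incompatible with $p$). Forcing iteration: $\langle\mathbb{P}_\alpha,\dot{\mathbb{Q}}_\beta : \alpha\leq\gamma,\beta<\gamma\rangle$ is a forcing iteration if (1) $\mathbb{P}_0=\{\mathbb{1}\}$; (2) for all $\alpha<\gamma$, $\mathbb{1}_{\mathbb{P}_\alpha}\Vdash$ ''$\dot{\mathbb{Q}}_\alpha$ is a notion of forcing''; (3) for $\alpha\leq\gamma$, conditions in $\mathbb{P}_\alpha$ are functions $p$ with domain $\alpha$ such that $\mathbb{1}_{\mathbb{P}_\beta}\Vdash p(\beta)\in\dot{\mathbb{Q}}_\beta$ for all $\beta<\alpha$; (4) for $p,q\in\mathbb{P}_\alpha$, $q\leq p$ iff for all $\beta<\alpha$, $q\upharpoonright\beta\leq_{\mathbb{P}_\beta}p\upharpoonright\beta$ and $q\upharpoonright\beta\Vdash_{\mathbb{P}_\beta}q(\beta)\leq p(\beta)$; (5) whenever $\beta<\alpha\leq\gamma$, $q\in\mathbb{P}_\beta$, $p\in\mathbb{P}_\alpha$ and $q\leq_{\mathbb{P}_\beta}p\upharpoonright\beta$,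 then $q\cup(p\upharpoonright(\alpha\setminus\beta))\in\mathbb{P}_\alpha$. Moreover $\mathbb{P}_{\alpha+1}\cong\mathbb{P}_\alpha*\dot{\mathbb{Q}}_\alpha$, and for $p\in\mathbb{P}_\gamma$, $\alpha\leq\gamma$, $p\upharpoonright\alpha\in\mathbb{P}_\alpha$. For $G\subseteq\mathbb{P}_\gamma$ $V$-generic, $G\upharpoonright\alpha=\{p\upharpoonright\alpha:p\in G\}$, which is $V$-generic for $\mathbb{P}_\alpha$. For $\delta<\gamma$, $\mathbb{P}/\delta$ is the canonical $\mathbb{P}_\delta$-name for the forcing given by the final $\gamma\setminus\delta$ iterands, so that $\mathbb{P}$ is viewed as $\mathbb{P}_\delta*\mathbb{P}/\delta$, and for $p\in\mathbb{P}$, $p/\delta$ is the canonical $\mathbb{P}_\delta$-name for the condition of $\mathbb{P}/\delta$ given by the final $\gamma\setminus\delta$ coordinates of $p$. $\kappa$-final: the iteration is $\kappa$-final if for all $V$-generic $G\subseteq\mathbb{P}_\gamma$, all $\eta<\kappa$ and all functions $b\colon\eta\to V$ in $V[G]$, there is $\alpha<\gamma$ with $b\in V[G\upharpoonright\alpha]$. Pseudodistributive: let $\mathcal{A}=\{A_\alpha:\alpha<\eta\}$ be a collection of maximal antichains in $\mathbb{P}=\mathbb{P}_\gamma$. A pseudorefinement of $\mathcal{A}$ is a maximal antichain $A$ in $\mathbb{P}$ such that for every $q\in A$ there is $\delta=\delta_q<\gamma$ such that for all $\alpha<\eta$, all $p\in A_\alpha$ and all $r\in\mathbb{P}$ with $r\leq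 p$ and $r\leq q$, we have $r\upharpoonright\delta\Vdash_{\mathbb{P}_\delta}q/\delta\leq p/\delta$. The iteration $\mathbb{P}$ is $\kappa$-pseudodistributive if for all $\eta<\kappa$ every collection $\{A_\alpha:\alpha<\eta\}$ of maximal antichains in $\mathbb{P}$ has a pseudorefinement. *)

(* Defs.v *)
From Stdlib Require Import ClassicalEpsilon FunctionalExtensionality
  PropExtensionality Wellfounded Relations.

(** * The universe of sets

    [V] is the extensional quotient of Aczel's type of well-founded trees: a set
    is a bisimulation class, so that Leibniz equality is extensional equality. *)

Inductive tree : Type := node (A : Type) (f : A -> tree).

Fixpoint bisim (s t : tree) : Prop :=
  match s, t with
  | node A f, node J g =>
      (forall i, exists j, bisim (f i) (g j)) /\
      (forall j, exists i, bisim (f i) (g j))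
  end.

Definition V : Type := {C : tree -> Prop | exists t, C = bisim t}.

Definition cls (t : tree) : V :=
  exist (fun C => exists t, C = bisim t) (bisim t) (ex_intro _ t eq_refl).

Definition mem (x y : V) : Prop :=
  exists (A : Type) (f : A -> tree), y = cls (node A f) /\ exists i, x = cls (f i).

Notation "x ∈ y" := (mem x y) (at level 70, no associativity).
Notation "x ∉ y" := (~ mem x y) (at level 70, no associativity).

Lemma bisim_refl t : bisim t t.
Proof. induction t as [A f IH]; simpl; split; intro i; exists i; apply IH. Qed.

Lemma bisim_sym s t : bisim s t -> bisim t s.
Proof.
  revert t; induction s as [A f IH]; intros [J g]; simpl; intros [H1 H2]; split.
  - intro j; destruct (H2 j) as [i Hi]; exists i; auto.
  - intro i; destruct (H1 i) as [j Hj]; exists j; auto.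
Qed.

Lemma bisim_trans s t u : bisim s t -> bisim t u -> bisim s u.
Proof.
  revert t u; induction s as [A f IH]; intros [J g] [K h]; simpl.
  intros [H1 H2] [H3 H4]; split.
  - intro i; destruct (H1 i) as [j Hj]; destruct (H3 j) as [k Hk]; eauto.
  - intro k; destruct (H4 k) as [j Hj]; destruct (H2 j) as [i Hi]; eauto.
Qed.

Lemma cls_eq s t : cls s = cls t <-> bisim s t.
Proof.
  split; intro H.
  - apply (f_equal (@proj1_sig _ _)) in H; simpl in H.
    rewrite H; apply bisim_refl.
  - assert (E : bisim s = bisim t).
    { apply functional_extensionality; intro u; apply propositional_extensionality.
      split; intro K; [apply bisim_trans with s | apply bisim_trans with t];
        auto using bisim_sym. }
    apply eq_sig_hprop; [intros; apply proof_irrelevance | exact E].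
Qed.

Lemma cls_surj (x : V) : exists A f, x = cls (node A f).
Proof.
  destruct x as [C [[A f] HC]]; exists A, f.
  apply eq_sig_hprop; [intros; apply proof_irrelevance | exact HC].
Qed.

Lemma mem_cls x A f : x ∈ cls (node A f) <-> exists i, x = cls (f i).
Proof.
  split.
  - intros (J & g & E & j & ->). apply cls_eq in E; destruct E as [_ E2].
    destruct (E2 j) as [i Hi]. exists i; apply cls_eq, bisim_sym, Hi.
  - intro H; exists A, f; auto.
Qed.

Lemma V_ext (x y : V) : (forall z, z ∈ x <-> z ∈ y) -> x = y.
Proof.
  destruct (cls_surj x) as (A & f & ->), (cls_surj y) as (J & g & ->).
  intro H; apply cls_eq; split.
  - intro i. destruct (proj1 (mem_cls _ J g) (proj1 (H (cls (f i)))
      (proj2 (mem_cls _ A f) (ex_intro _ i eq_refl)))) as [j Hj].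
    exists j; now apply cls_eq.
  - intro j. destruct (proj1 (mem_cls _ A f) (proj2 (H (cls (g j)))
      (proj2 (mem_cls _ J g) (ex_intro _ j eq_refl)))) as [i Hi].
    exists i; now apply cls_eq, eq_sym.
Qed.

Lemma mem_wf : well_founded mem.
Proof.
  intro x; destruct (cls_surj x) as (A & f & ->).
  generalize (node A f) as t; clear A f; induction t as [A f IH].
  constructor; intros y Hy; apply mem_cls in Hy as [i ->]; apply IH.
Qed.

(** A class is small when it is a set. *)
Definition small (Φ : V -> Prop) : Prop := exists y, forall z, z ∈ y <-> Φ z.

Lemma small_range (A : Type) (f : A -> V) : small (fun z => exists i, z = f i).
Proof.
  pose (rep := fun x : V => epsilon (inhabits (node Empty_set (fun e => match e with end)))
                 (fun t => x = cls t)).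
  assert (repE : forall x, x = cls (rep x)).
  { intro x; unfold rep; apply epsilon_spec.
    destruct (cls_surj x) as (J & g & ->); eauto. }
  exists (cls (node A (fun i => rep (f i)))); intro z; rewrite mem_cls.
  split; intros [i Hi]; exists i; [rewrite repE | rewrite <- repE]; auto.
Qed.

Lemma small_mem x : small (fun z => z ∈ x).
Proof. exists x; tauto. Qed.

Lemma small_sub (Φ Ψ : V -> Prop) :
  small Ψ -> (forall z, Φ z -> Ψ z) -> small Φ.
Proof.
  intros [x Hx] H; destruct (cls_surj x) as (A & f & ->).
  destruct (small_range {i : A | Φ (cls (f i))} (fun i => cls (f (proj1_sig i)))) as [y Hy].
  exists y; intro z; rewrite Hy; split.
  - intros [[i Hi] ->]; exact Hi.
  - intro Hz. destruct (proj1 (mem_cls _ _ _) (proj2 (Hx z) (H z Hz))) as [i ->].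
    exists (exist _ i Hz); reflexivity.
Qed.

Lemma small_bigcup (Φ : V -> Prop) (Ψ : V -> V -> Prop) :
  small Φ -> (forall u, Φ u -> small (Ψ u)) ->
  small (fun z => exists u, Φ u /\ Ψ u z).
Proof.
  intros [x Hx] HΨ; destruct (cls_surj x) as (A & f & ->).
  pose (ix := fun y : V => epsilon (inhabits (existT (fun J : Type => J -> tree)
     Empty_set (fun e => match e with end))) (fun J => y = cls (node (projT1 J) (projT2 J)))).
  assert (ixE : forall y, y = cls (node (projT1 (ix y)) (projT2 (ix y)))).
  { intro y; unfold ix; apply epsilon_spec.
    destruct (cls_surj y) as (J & g & ->); now exists (existT _ J g). }
  pose (F := fun i => epsilon (inhabits (cls (f i))) (fun y => forall z, z ∈ y <-> Ψ (cls (f i)) z)).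
  assert (FE : forall i z, z ∈ F i <-> Ψ (cls (f i)) z).
  { intro i; unfold F; apply epsilon_spec; apply HΨ, Hx, mem_cls; eauto. }
  destruct (small_range {i : A & projT1 (ix (F i))}
    (fun k => cls (projT2 (ix (F (projT1 k))) (projT2 k)))) as [y Hy].
  exists y; intro z; rewrite Hy; split.
  - intros [[i j] ->]; exists (cls (f i)); split; [apply Hx, mem_cls; eauto|].
    apply FE; simpl; rewrite (ixE (F i)) at 2; apply mem_cls; eauto.
  - intros (u & Hu & Hz); apply Hx, mem_cls in Hu as [i ->].
    apply FE in Hz; rewrite (ixE (F i)) in Hz; apply mem_cls in Hz as [j ->].
    now exists (existT _ i j).
Qed.

Lemma small_eq x : small (fun z => z = x).
Proof.
  destruct (small_range unit (fun _ => x)) as [y Hy]; exists y; intro z; rewrite Hy.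
  split; [intros [_ H]; exact H | intro H; exists tt; exact H].
Qed.

Lemma small_image (Φ : V -> Prop) (F : V -> V) :
  small Φ -> small (fun z => exists u, Φ u /\ z = F u).
Proof. intro H; apply small_bigcup; [exact H | intros; apply small_eq]. Qed.

Lemma small_or (Φ Ψ : V -> Prop) :
  small Φ -> small Ψ -> small (fun z => Φ z \/ Ψ z).
Proof.
  intros [x Hx] [y Hy]; destruct (cls_surj x) as (A & f & ->), (cls_surj y) as (J & g & ->).
  destruct (small_range (A + J) (fun k => match k with inl i => cls (f i) | inr j => cls (g j) end))
    as [w Hw].
  exists w; intro z; rewrite Hw, <- Hx, <- Hy, !mem_cls; split.
  - intros [[i|j] ->]; eauto.
  - intros [[i ->]|[j ->]]; [now exists (inl i) | now exists (inr j)].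
Qed.

Lemma small_empty : small (fun _ => False).
Proof.
  destruct (small_range Empty_set (fun e => match e with end)) as [y Hy].
  exists y; intro z; rewrite Hy; split; [intros [[] _] | intros []].
Qed.

Definition V0 : V := cls (node Empty_set (fun e => match e with end)).

(** [setof Φ] is the set of all [z] with [Φ z], provided [Φ] is small (and is
    unspecified otherwise). *)
Definition setof (Φ : V -> Prop) : V :=
  epsilon (inhabits V0) (fun y => forall z, z ∈ y <-> Φ z).

Lemma mem_setof Φ : small Φ -> forall z, z ∈ setof Φ <-> Φ z.
Proof. intro H; unfold setof; apply epsilon_spec; exact H. Qed.

Lemma mem_V0 z : ~ z ∈ V0.
Proof. intro H; apply mem_cls in H as [[] _]. Qed.

(** ** Elementary set theory *)

Definition upair (x y : V) : V := setof (fun z => z = x \/ z = y).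
Definition opair (x y : V) : V := upair (upair x x) (upair x y).
Definition union (x y : V) : V := setof (fun z => z ∈ x \/ z ∈ y).
Definition diff (x y : V) : V := setof (fun z => z ∈ x /\ z ∉ y).
Definition succ (x : V) : V := union x (upair x x).

Definition transitive_set (x : V) : Prop :=
  forall y z, y ∈ x -> z ∈ y -> z ∈ x.

Definition ordinal (x : V) : Prop :=
  transitive_set x /\ forall y z, y ∈ x -> z ∈ x -> y ∈ z \/ y = z \/ z ∈ y.

Definition ole (α β : V) : Prop := α ∈ β \/ α = β.

Definition is_function_on (p d : V) : Prop :=
  (forall z, z ∈ p -> exists a y, a ∈ d /\ z = opair a y) /\
  (forall a, a ∈ d -> exists! y, opair a y ∈ p).

Definition app (p a : V) : V := epsilon (inhabits V0) (fun y => opair a y ∈ p).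

Definition restrict (p d : V) : V :=
  setof (fun z => z ∈ p /\ exists a y, a ∈ d /\ z = opair a y).

Lemma mem_upair x y z : z ∈ upair x y <-> z = x \/ z = y.
Proof. apply mem_setof, small_or; apply small_eq. Qed.

Lemma mem_union x y z : z ∈ union x y <-> z ∈ x \/ z ∈ y.
Proof. apply mem_setof, small_or; apply small_mem. Qed.

Lemma mem_diff x y z : z ∈ diff x y <-> z ∈ x /\ z ∉ y.
Proof. apply mem_setof, small_sub with (1 := small_mem x); tauto. Qed.

Lemma mem_restrict p d z :
  z ∈ restrict p d <-> z ∈ p /\ exists a y, a ∈ d /\ z = opair a y.
Proof. apply mem_setof, small_sub with (1 := small_mem p); tauto. Qed.

Lemma opair_inj x y x' y' : opair x y = opair x' y' -> x = x' /\ y = y'.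
Proof.
  unfold opair; intro E.
  assert (U : forall a b c d, upair a b = upair c d -> (a = c /\ b = d) \/ (a = d /\ b = c)).
  { intros a b c d H.
    assert (Ha : a = c \/ a = d) by (apply mem_upair; rewrite <- H; apply mem_upair; auto).
    assert (Hb : b = c \/ b = d) by (apply mem_upair; rewrite <- H; apply mem_upair; auto).
    assert (Hc : c = a \/ c = b) by (apply mem_upair; rewrite H; apply mem_upair; auto).
    assert (Hd : d = a \/ d = b) by (apply mem_upair; rewrite H; apply mem_upair; auto).
    intuition congruence. }
  apply U in E as [[E1 E2]|[E1 E2]]; apply U in E1, E2; intuition congruence.
Qed.

Lemma app_eq p d a y :
  is_function_on p d -> a ∈ d -> opair a y ∈ p -> app p a = y.
Proof.
  intros [_ H] Ha Hy; destruct (H a Ha) as (y' & H1 & H2).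
  rewrite <- (H2 y Hy); symmetry; apply H2.
  unfold app; apply epsilon_spec; eauto.
Qed.

(** * Forcing

    Only the restriction of [le] to [car] matters. *)

Record poset := Poset { car : V; le : V -> V -> Prop; top : V }.

(** Antisymmetry is not demanded: the order of a forcing iteration compares
    coordinates up to forced equality only. *)
Definition forcing_notion (P : poset) : Prop :=
  (forall p, p ∈ car P -> le P p p) /\
  (forall p q r, p ∈ car P -> q ∈ car P -> r ∈ car P ->
     le P p q -> le P q r -> le P p r) /\
  top P ∈ car P /\
  (forall p, p ∈ car P -> le P p (top P)).

Definition compatible (P : poset) (p q : V) : Prop :=
  exists r, r ∈ car P /\ le P r p /\ le P r q.

Definition separative (P : poset) : Prop :=
  forall p' p, p' ∈ car P -> p ∈ car P -> ~ le P p' p ->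
  exists q, q ∈ car P /\ le P q p' /\ ~ compatible P q p.

Definition maximal_antichain (P : poset) (A : V) : Prop :=
  (forall p, p ∈ A -> p ∈ car P) /\
  (forall p q, p ∈ A -> q ∈ A -> p <> q -> ~ compatible P p q) /\
  (forall p, p ∈ car P -> exists q, q ∈ A /\ compatible P p q).

(** ** Names *)

Inductive is_name (P : poset) (τ : V) : Prop :=
  is_name_intro :
    (forall z, z ∈ τ -> exists σ p, z = opair σ p /\ is_name P σ /\ p ∈ car P) ->
    is_name P τ.

(** [check P x] is the canonical name of the ground model set [x]. *)
Definition check (P : poset) : V -> V :=
  Fix mem_wf (fun _ => V)
    (fun x rec => setof (fun z => exists y (h : y ∈ x), z = opair (rec y h) (top P))).

Lemma check_eq P x :
  check P x = setof (fun z => exists y, y ∈ x /\ z = opair (check P y) (top P)).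
Proof.
  unfold check at 1; rewrite Fix_eq.
  - f_equal; apply functional_extensionality; intro z; apply propositional_extensionality.
    split; [intros (y & h & ->) | intros (y & h & ->)]; eauto.
  - intros y f g H; f_equal; apply functional_extensionality; intro z.
    apply propositional_extensionality.
    split; intros (u & h & ->); exists u, h; now rewrite H.
Qed.

Lemma mem_check P x z :
  z ∈ check P x <-> exists y, y ∈ x /\ z = opair (check P y) (top P).
Proof.
  rewrite check_eq at 1; apply mem_setof.
  apply small_image with (Φ := fun y => y ∈ x), small_mem.
Qed.

(** Names of unordered and ordered pairs. *)
Definition upair_name (P : poset) (σ τ : V) : V :=
  upair (opair σ (top P)) (opair τ (top P)).
Definition opair_name (P : poset) (σ τ : V) : V :=
  upair_name P (upair_name P σ σ) (upair_name P σ τ).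

(** ** The forcing relation

    A statement of the forcing language is identified with the predicate on
    conditions "[p] forces it". *)

Definition statement := V -> Prop.

Definition forces (p : V) (φ : statement) : Prop := φ p.

(** [p] forces [σ = τ] iff below [p] every condition putting an element into one
    of the names densely forces that element to equal an element put into the
    other one. By well-foundedness of names this recursion has a unique
    solution, so taking its least one is harmless. *)
Inductive forces_eq (P : poset) (p σ τ : V) : Prop :=
  forces_eq_intro :
    (forall σ' s q, opair σ' s ∈ σ -> q ∈ car P -> le P q p -> le P q s ->
       exists r, r ∈ car P /\ le P r q /\
       exists τ' t, opair τ' t ∈ τ /\ le P r t /\ forces_eq P r σ' τ') ->
    (forall τ' t q, opair τ' t ∈ τ -> q ∈ car P -> le P q p -> le P q t ->
       exists r, r ∈ car P /\ le P r q /\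
       exists σ' s, opair σ' s ∈ σ /\ le P r s /\ forces_eq P r σ' τ') ->
    forces_eq P p σ τ.

Definition dense_below (P : poset) (p : V) (φ : statement) : Prop :=
  forall q, q ∈ car P -> le P q p -> exists r, r ∈ car P /\ le P r q /\ φ r.

Definition Eq (P : poset) (σ τ : V) : statement := fun p => forces_eq P p σ τ.

Definition Mem (P : poset) (σ τ : V) : statement := fun p =>
  dense_below P p (fun r => exists τ' t, opair τ' t ∈ τ /\ le P r t /\ Eq P σ τ' r).

Definition And (φ ψ : statement) : statement := fun p => φ p /\ ψ p.

Definition Imp (P : poset) (φ ψ : statement) : statement := fun p =>
  forall q, q ∈ car P -> le P q p -> φ q -> ψ q.

(** Quantifiers ranging over a class [D] of ground model objects. Quantification
    over the extension is the case [D = is_name P]; quantification over the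
    elements of the ground model is quantification over some [x] that enters the
    statement as [check P x]. *)
Definition All (D : V -> Prop) (φ : V -> statement) : statement := fun p =>
  forall x, D x -> φ x p.

Definition Ex (P : poset) (D : V -> Prop) (φ : V -> statement) : statement := fun p =>
  dense_below P p (fun r => exists x, D x /\ φ x r).

Definition ground (x : V) : Prop := True.

(** * Forcing iterations *)

(** Names for the underlying set, the order and the largest element of an iterand. *)
Record poset_name := PosetName { ncar : V; nle : V; ntop : V }.

Definition Le (P : poset) (Q : poset_name) (σ τ : V) : statement :=
  Mem P (opair_name P σ τ) (nle Q).

Definition Is_forcing_notion (P : poset) (Q : poset_name) : statement :=
  let N := is_name P in
  let inQ x := Mem P x (ncar Q) in
  And (All N (fun x => Imp P (inQ x) (Le P Q x x)))
  (And (All N (fun x => All N (fun y => All N (fun z =>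
     Imp P (inQ x) (Imp P (inQ y) (Imp P (inQ z)
       (Imp P (Le P Q x y) (Imp P (Le P Q y z) (Le P Q x z)))))))))
  (And (All N (fun x => All N (fun y =>
     Imp P (inQ x) (Imp P (inQ y)
       (Imp P (Le P Q x y) (Imp P (Le P Q y x) (Eq P x y)))))))
  (And (inQ (ntop Q))
       (All N (fun x => Imp P (inQ x) (Le P Q x (ntop Q))))))).

Record is_iteration (γ : V) (P : V -> poset) (Q : V -> poset_name) : Prop := {
  iter_length : ordinal γ;
  iter_notion : forall α, ole α γ -> forcing_notion (P α);
  iter_zero : forall p, p ∈ car (P V0) <-> p = top (P V0);
  iter_iterand_name : forall β, β ∈ γ ->
    is_name (P β) (ncar (Q β)) /\ is_name (P β) (nle (Q β)) /\ is_name (P β) (ntop (Q β));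
  iter_iterand : forall β, β ∈ γ ->
    forces (top (P β)) (Is_forcing_notion (P β) (Q β));
  iter_cond : forall α p, ole α γ -> p ∈ car (P α) ->
    is_function_on p α /\
    forall β, β ∈ α ->
      is_name (P β) (app p β) /\
      forces (top (P β)) (Mem (P β) (app p β) (ncar (Q β)));
  iter_restrict : forall α β p, ole α γ -> ole β α -> p ∈ car (P α) ->
    restrict p β ∈ car (P β);
  iter_le : forall α p q, ole α γ -> p ∈ car (P α) -> q ∈ car (P α) ->
    (le (P α) q p <->
     forall β, β ∈ α ->
       le (P β) (restrict q β) (restrict p β) /\
       forces (restrict q β) (Le (P β) (Q β) (app q β) (app p β)));
  iter_amalgam : forall α β p q, ole α γ -> β ∈ α ->
    q ∈ car (P β) -> p ∈ car (P α) -> le (P β) q (restrict p β) ->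
    union q (restrict p (diff α β)) ∈ car (P α);
  (* [P (succ α)] is the two-step iteration of [P α] and [Q α]: by [iter_le] the
     map [r |-> (restrict r α, app r α)] is an order embedding, and here it is
     onto up to equivalence of conditions. *)
  iter_succ : forall α p τ, α ∈ γ -> p ∈ car (P α) -> is_name (P α) τ ->
    forces (top (P α)) (Mem (P α) τ (ncar (Q α))) ->
    exists r, r ∈ car (P (succ α)) /\
      le (P α) (restrict r α) p /\ le (P α) p (restrict r α) /\
      forces p (Eq (P α) (app r α) τ)
}.

(** ** Intermediate extensions *)

Definition in_dom (σ τ : V) : Prop := exists r, opair σ r ∈ τ.

Lemma in_dom_wf : well_founded in_dom.
Proof.
  apply wf_incl with (clos_trans V mem); [|apply wf_clos_trans, mem_wf].
  intros σ τ [r H].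
  apply t_trans with (opair σ r); [|now apply t_step].
  apply t_trans with (upair σ σ); apply t_step; apply mem_upair; auto.
Qed.

(** If [τ] is a [P α]-name and [G] is generic for [P γ], then [lift P γ α τ],
    evaluated by [G], is the evaluation of [τ] by the generic filter
    [{restrict p α | p ∈ G}] of [P α]. *)
Definition lift (P : V -> poset) (γ α : V) : V -> V :=
  Fix in_dom_wf (fun _ => V)
    (fun τ rec => setof (fun z => exists σ (h : in_dom σ τ) p,
       p ∈ car (P γ) /\ opair σ (restrict p α) ∈ τ /\ z = opair (rec σ h) p)).

Lemma mem_lift P γ α τ z :
  z ∈ lift P γ α τ <->
  exists σ p, p ∈ car (P γ) /\ opair σ (restrict p α) ∈ τ /\
    z = opair (lift P γ α σ) p.
Proof.
  assert (E : lift P γ α τ = setof (fun z => exists σ p, p ∈ car (P γ) /\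
    opair σ (restrict p α) ∈ τ /\ z = opair (lift P γ α σ) p)).
  { unfold lift at 1; rewrite Fix_eq.
    - f_equal; apply functional_extensionality; intro u; apply propositional_extensionality.
      split.
      + intros (σ & h & p & H1 & H2 & ->); eauto.
      + intros (σ & p & H1 & H2 & ->).
        exists σ, (ex_intro _ (restrict p α) H2), p; auto.
    - intros y f g H; f_equal; apply functional_extensionality; intro u.
      apply propositional_extensionality.
      split; intros (σ & h & p & H1 & H2 & ->); exists σ, h, p; rewrite H; auto. }
  rewrite E; apply mem_setof; clear E z.
  apply small_sub with (Ψ := fun z => exists p, p ∈ car (P γ) /\
    exists w, w ∈ τ /\
      z = opair (lift P γ α (epsilon (inhabits V0) (fun σ => opair σ (restrict p α) = w))) p).
  - apply small_bigcup with (Φ := fun p => p ∈ car (P γ)); [apply small_mem|].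
    intros p _; apply small_image with (Φ := fun w => w ∈ τ), small_mem.
  - intros z (σ & p & H1 & H2 & ->); exists p; split; [exact H1|].
    exists (opair σ (restrict p α)); split; [exact H2|].
    assert (H := epsilon_spec (inhabits V0)
      (fun σ' => opair σ' (restrict p α) = opair σ (restrict p α)) (ex_intro _ σ eq_refl)).
    apply opair_inj in H as [H _]; now rewrite H.
Qed.

(** "[b] is a function from [η] to the ground model" *)
Definition Is_ground_valued_function (P : poset) (η b : V) : statement :=
  let at_ a x := opair_name P (check P a) (check P x) in
  let inη a := a ∈ η in
  And (All (is_name P) (fun z => Imp P (Mem P z b)
         (Ex P inη (fun a => Ex P ground (fun x => Eq P z (at_ a x))))))
  (And (All inη (fun a => Ex P ground (fun x => Mem P (at_ a x) b)))
       (All inη (fun a => All ground (fun x => All ground (fun y =>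
          Imp P (Mem P (at_ a x) b) (Imp P (Mem P (at_ a y) b)
            (Eq P (check P x) (check P y)))))))).

(** "[b] belongs to the extension by the restriction of the generic to [α]" *)
Definition In_intermediate (P : V -> poset) (γ α b : V) : statement :=
  Ex (P γ) (is_name (P α)) (fun c => Eq (P γ) b (lift P γ α c)).

(** "For all generic [G]" means: forced by the largest condition. *)
Definition final (γ : V) (P : V -> poset) (κ : V) : Prop :=
  forall η, η ∈ κ ->
  forces (top (P γ))
    (All (is_name (P γ)) (fun b =>
       Imp (P γ) (Is_ground_valued_function (P γ) η b)
         (Ex (P γ) (fun α => α ∈ γ) (fun α => In_intermediate P γ α b)))).

(** ** Quotients

    In the extension by a generic [G] for [P δ], the quotient consists of the
    tails [restrict p (diff γ δ)], ordered by [f <= g] iff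
    [union s f <= union s g] for some [s ∈ G]. *)

Definition tail (γ δ p : V) : V := restrict p (diff γ δ).

Definition quotient_cond (P : V -> poset) (γ δ p : V) : V :=
  check (P δ) (tail γ δ p).

Definition quotient_le (P : V -> poset) (γ δ : V) : V :=
  setof (fun z => exists q p s,
    q ∈ car (P γ) /\ p ∈ car (P γ) /\ s ∈ car (P δ) /\
    union s (tail γ δ q) ∈ car (P γ) /\
    union s (tail γ δ p) ∈ car (P γ) /\
    le (P γ) (union s (tail γ δ q)) (union s (tail γ δ p)) /\
    z = opair (opair_name (P δ) (quotient_cond P γ δ q) (quotient_cond P γ δ p)) s).

Lemma mem_quotient_le P γ δ z :
  z ∈ quotient_le P γ δ <-> exists q p s,
    q ∈ car (P γ) /\ p ∈ car (P γ) /\ s ∈ car (P δ) /\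
    union s (tail γ δ q) ∈ car (P γ) /\
    union s (tail γ δ p) ∈ car (P γ) /\
    le (P γ) (union s (tail γ δ q)) (union s (tail γ δ p)) /\
    z = opair (opair_name (P δ) (quotient_cond P γ δ q) (quotient_cond P γ δ p)) s.
Proof.
  apply mem_setof.
  apply small_sub with (Ψ := fun z => exists q, q ∈ car (P γ) /\ exists p, p ∈ car (P γ) /\
    exists s, s ∈ car (P δ) /\
    z = opair (opair_name (P δ) (quotient_cond P γ δ q) (quotient_cond P γ δ p)) s).
  - apply small_bigcup with (Φ := fun q => q ∈ car (P γ)); [apply small_mem | intros q _].
    apply small_bigcup with (Φ := fun p => p ∈ car (P γ)); [apply small_mem | intros p _].
    apply small_image with (Φ := fun s => s ∈ car (P δ)), small_mem.
  - intros u (q & p & s & H); exists q; split; [tauto|]; exists p; split; [tauto|].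
    exists s; tauto.
Qed.

Definition Quotient_le (P : V -> poset) (γ δ q p : V) : statement :=
  Mem (P δ) (opair_name (P δ) (quotient_cond P γ δ q) (quotient_cond P γ δ p))
      (quotient_le P γ δ).

Definition pseudorefinement (γ : V) (P : V -> poset) (η : V) (A : V -> V) (B : V) : Prop :=
  maximal_antichain (P γ) B /\
  forall q, q ∈ B -> exists δ, δ ∈ γ /\
    forall α p r, α ∈ η -> p ∈ A α -> r ∈ car (P γ) ->
      le (P γ) r p -> le (P γ) r q ->
      forces (restrict r δ) (Quotient_le P γ δ q p).

(** By replacement, an indexed family of sets is the same as the restriction to
    the index set [η] of some [A : V -> V]. *)
Definition pseudodistributive (γ : V) (P : V -> poset) (κ : V) : Prop :=
  forall (η : V) (A : V -> V), η ∈ κ ->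
    (forall α, α ∈ η -> maximal_antichain (P γ) (A α)) ->
    exists B, pseudorefinement γ P η A B.

(* Main.v *)
(** If [b] is a function with ground model values and [q] forces that [b] is the
    value of a [P δ]-name, then every value [b(a)] that is decided by some [r <= q]
    is already decided by [restrict r δ]. Final implies pseudodistributive: apply
    this to the function [b] picking the generic element of each antichain [A a].
    If [r <= q] and [r <= p] with [p ∈ A a], then [restrict r δ], continued by the
    tail of [q], forces [p] into the generic filter, so by separativity it is below
    [p], and the quotient order is decided by [restrict r δ].

    Conversely, let [A a] be a maximal antichain deciding [b(a)] and [q] a member of
    a pseudorefinement. Below [q], an element [p] of [A a] is in the generic filter
    iff the restricted filter contains [restrict t δ] for some [t] below [p] and
    [q]; hence a [P δ]-name computes [b]. *)

From Stdlib Require Import ClassicalEpsilon FunctionalExtensionality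
  PropExtensionality.
From mathcomp Require classical_sets.
Require Import Defs.

(** * Sets *)

Lemma mem_asym x y : x ∈ y -> y ∉ x.
Proof.
  revert y; induction x as [x IH] using (well_founded_ind mem_wf).
  intros y H K; exact (IH y K x K H).
Qed.

Lemma mem_acyclic3 x y z : x ∈ y -> y ∈ z -> z ∉ x.
Proof.
  revert y z; induction x as [x IH] using (well_founded_ind mem_wf).
  intros y z H K L; exact (IH z L x y L H K).
Qed.

(** [ξ] and [α] are comparable inside [γ]; the two unwanted cases would close a membership cycle of
    length two or three. *)
Lemma ordinal_mem_trans γ α β ξ :
  ordinal γ -> α ∈ γ -> β ∈ α -> ξ ∈ β -> ξ ∈ α.
Proof.
  intros [T L] Hα Hβ Hξ.
  assert (Hβγ := T _ _ Hα Hβ); assert (Hξγ := T _ _ Hβγ Hξ).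
  destruct (L _ _ Hξγ Hα) as [H|[->|H]]; auto.
  - exfalso; exact (mem_asym _ _ Hξ Hβ).
  - exfalso; exact (mem_acyclic3 _ _ _ Hξ Hβ H).
Qed.

(** No functionality is assumed: [app] chooses from a predicate, and equal predicates yield the same
    choice even where no value exists. *)
Lemma app_ext p q a : (forall y, opair a y ∈ p <-> opair a y ∈ q) -> app p a = app q a.
Proof.
  intro H; unfold app; f_equal; apply functional_extensionality; intro y.
  apply propositional_extensionality, H.
Qed.

Lemma app_restrict p d a : a ∈ d -> app (restrict p d) a = app p a.
Proof. intro Ha; apply app_ext; intro y; rewrite mem_restrict; split; [tauto | eauto]. Qed.

Lemma restrict_restrict p d e :
  (forall a, a ∈ e -> a ∈ d) -> restrict (restrict p d) e = restrict p e.
Proof.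
  intro H; apply V_ext; intro z; rewrite !mem_restrict; split; [tauto|].
  intros (Hz & a & y & Ha & E); split; [|eauto]; split; [exact Hz|]; eauto.
Qed.

Lemma restrict_full p d : is_function_on p d -> restrict p d = p.
Proof.
  intros [H _]; apply V_ext; intro z; rewrite mem_restrict; split; [tauto|].
  intro Hz; split; [exact Hz | apply H, Hz].
Qed.

Lemma mem_tail γ δ p a y :
  opair a y ∈ tail γ δ p <-> opair a y ∈ p /\ a ∈ γ /\ a ∉ δ.
Proof.
  unfold tail; rewrite mem_restrict; split.
  - intros (H & a' & y' & Ha & E); apply opair_inj in E as [<- <-].
    now apply mem_diff in Ha.
  - intros (H & Ha); split; [exact H|]; exists a, y; now rewrite mem_diff.
Qed.

Lemma restrict_union_tail γ δ s p :
  is_function_on s δ -> restrict (union s (tail γ δ p)) δ = s.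
Proof.
  intros [H _]; apply V_ext; intro z; rewrite mem_restrict, mem_union; split.
  - intros ([Hz|Hz] & a & y & Ha & ->); [exact Hz|].
    apply mem_tail in Hz; tauto.
  - intro Hz; split; [now left | apply H, Hz].
Qed.

Lemma app_union_tail γ δ s p a :
  is_function_on s δ -> a ∈ γ -> a ∉ δ -> app (union s (tail γ δ p)) a = app p a.
Proof.
  intros [H _] Ha Ha'; apply app_ext; intro y; rewrite mem_union, mem_tail.
  split; [|tauto]; intros [Hy|Hy]; [exfalso|tauto].
  destruct (H _ Hy) as (a' & y' & Ha'' & E); apply opair_inj in E as [-> _]; tauto.
Qed.

(** * Forcing *)

(** This is Leibniz equality of names rather than forced equality, so it can be used for
    rewriting. *)
Lemma check_opair P x y : opair_name P (check P x) (check P y) = check P (opair x y).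
Proof.
  assert (E : forall u v, upair_name P (check P u) (check P v) = check P (upair u v)).
  { intros u v; apply V_ext; intro z; unfold upair_name.
    rewrite mem_check, mem_upair; split.
    - intros [->| ->]; eexists; rewrite mem_upair; eauto.
    - intros (w & Hw & ->); apply mem_upair in Hw as [->| ->]; auto. }
  unfold opair_name, opair; now rewrite !E.
Qed.

Lemma is_name_check P x : top P ∈ car P -> is_name P (check P x).
Proof.
  intro H1; induction x as [x IH] using (well_founded_ind mem_wf).
  constructor; intros z Hz; apply mem_check in Hz as (y & Hy & ->).
  exists (check P y), (top P); auto.
Qed.

Section Forcing.
Context {P : poset} (HP : forcing_notion P).

Lemma le_refl p : p ∈ car P -> le P p p.
Proof. apply HP. Qed.

Lemma le_trans p q r : p ∈ car P -> q ∈ car P -> r ∈ car P ->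
  le P p q -> le P q r -> le P p r.
Proof. apply HP. Qed.

Lemma top_mem : top P ∈ car P.
Proof. apply HP. Qed.

Lemma le_top p : p ∈ car P -> le P p (top P).
Proof. apply HP. Qed.

Lemma dense_below_mono p q φ : p ∈ car P -> q ∈ car P -> le P q p ->
  dense_below P p φ -> dense_below P q φ.
Proof. intros Hp Hq L H r Hr Lr; apply H; eauto using le_trans. Qed.

Lemma dense_below_idem p φ :
  dense_below P p (fun r => dense_below P r φ) -> dense_below P p φ.
Proof.
  intros H q Hq L; destruct (H q Hq L) as (r & Hr & Lr & K).
  destruct (K r Hr (le_refl r Hr)) as (s & Hs & Ls & Ks).
  exists s; eauto using le_trans.
Qed.

Lemma dense_below_intro p (φ : statement) : p ∈ car P ->
  (forall q, q ∈ car P -> le P q p -> φ q) -> dense_below P p φ.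
Proof. intros Hp H q Hq L; exists q; auto using le_refl. Qed.

(** * Forced equality and membership *)

Lemma Eq_mono p q σ τ : p ∈ car P -> q ∈ car P -> le P q p ->
  Eq P σ τ p -> Eq P σ τ q.
Proof.
  intros Hp Hq L [H1 H2]; constructor; intros; [eapply H1 | eapply H2]; eauto using le_trans.
Qed.

Lemma Eq_refl σ p : p ∈ car P -> Eq P σ σ p.
Proof.
  revert p; induction σ as [σ IH] using (well_founded_ind in_dom_wf); intros p Hp.
  constructor; intros σ' s q Hs Hq Lp Ls; exists q; (split; [exact Hq|]);
    (split; [auto using le_refl|]); exists σ', s; (split; [exact Hs|]); split; auto;
    apply IH; auto; now exists s.
Qed.

Lemma Eq_sym σ τ p : Eq P σ τ p -> Eq P τ σ p.
Proof.
  revert τ p; induction σ as [σ IH] using (well_founded_ind in_dom_wf); intros τ p [H1 H2].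
  constructor; intros ρ s q Hs Hq Lp Ls.
  - destruct (H2 ρ s q Hs Hq Lp Ls) as (r & Hr & Lr & σ' & t & Ht & Lt & K).
    exists r; split; [|split]; auto; exists σ', t; split; [|split]; auto.
    apply IH; [now exists t | exact K].
  - destruct (H1 ρ s q Hs Hq Lp Ls) as (r & Hr & Lr & τ' & t & Ht & Lt & K).
    exists r; split; [|split]; auto; exists τ', t; split; [|split]; auto.
    apply IH; [now exists s | exact K].
Qed.

Lemma Eq_trans σ τ υ p : p ∈ car P -> Eq P σ τ p -> Eq P τ υ p -> Eq P σ υ p.
Proof.
  revert τ υ p; induction σ as [σ IH] using (well_founded_ind in_dom_wf).
  intros τ υ p Hp [H1 H2] [K1 K2]; constructor.
  - intros σ' s q Hs Hq Lp Ls.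
    destruct (H1 σ' s q Hs Hq Lp Ls) as (r & Hr & Lr & τ' & t & Ht & Lt & E).
    destruct (K1 τ' t r Ht Hr) as (r' & Hr' & Lr' & υ' & u & Hu & Lu & F);
      eauto using le_trans.
    exists r'; split; [|split]; eauto using le_trans.
    exists υ', u; split; [|split]; auto.
    apply IH with τ'; auto; [now exists s|].
    exact (Eq_mono r r' σ' τ' Hr Hr' Lr' E).
  - intros υ' u q Hu Hq Lp Lu.
    destruct (K2 υ' u q Hu Hq Lp Lu) as (r & Hr & Lr & τ' & t & Ht & Lt & E).
    destruct (H2 τ' t r Ht Hr) as (r' & Hr' & Lr' & σ' & s & Hs & Ls & F);
      eauto using le_trans.
    exists r'; split; [|split]; eauto using le_trans.
    exists σ', s; split; [|split]; auto.
    apply IH with τ'; auto; [now exists s|].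
    exact (Eq_mono r r' τ' υ' Hr Hr' Lr' E).
Qed.

Lemma Mem_mono p q σ τ : p ∈ car P -> q ∈ car P -> le P q p ->
  Mem P σ τ p -> Mem P σ τ q.
Proof. apply dense_below_mono. Qed.

Lemma Mem_intro p σ s τ : p ∈ car P -> s ∈ car P -> opair σ s ∈ τ -> le P p s ->
  Mem P σ τ p.
Proof.
  intros Hp Hs H L; apply dense_below_intro; [exact Hp|]; intros q Hq Lq.
  exists σ, s; split; [exact H|]; split; [eauto using le_trans | now apply Eq_refl].
Qed.

Lemma Mem_eq_l σ σ' τ p : p ∈ car P -> Eq P σ σ' p -> Mem P σ τ p -> Mem P σ' τ p.
Proof.
  intros Hp E H q Hq L; destruct (H q Hq L) as (r & Hr & Lr & τ' & t & Ht & Lt & F).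
  exists r; split; [|split]; auto; exists τ', t; split; [|split]; auto.
  apply Eq_trans with σ; auto.
  apply Eq_sym, Eq_mono with p; eauto using le_trans.
Qed.

Lemma Mem_eq_r σ τ τ' p : p ∈ car P -> Eq P τ τ' p -> Mem P σ τ p -> Mem P σ τ' p.
Proof.
  intros Hp [E _] H q Hq L; destruct (H q Hq L) as (r & Hr & Lr & ρ & t & Ht & Lt & F).
  destruct (E ρ t r Ht Hr) as (r' & Hr' & Lr' & ρ' & t' & Ht' & Lt' & F');
    eauto using le_trans.
  exists r'; split; [|split]; eauto using le_trans.
  exists ρ', t'; split; [|split]; auto.
  apply Eq_trans with ρ; auto; apply Eq_mono with r; auto.
Qed.

(** The density built into [Mem], evaluated at the test condition itself, supplies the extension
    that [forces_eq] demands. *)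
Lemma Eq_intro σ τ p :
  (forall σ' s q, opair σ' s ∈ σ -> q ∈ car P -> le P q p -> le P q s -> Mem P σ' τ q) ->
  (forall τ' t q, opair τ' t ∈ τ -> q ∈ car P -> le P q p -> le P q t -> Mem P τ' σ q) ->
  Eq P σ τ p.
Proof.
  intros H1 H2; constructor.
  - intros σ' s q Hs Hq Lp Ls; exact (H1 σ' s q Hs Hq Lp Ls q Hq (le_refl q Hq)).
  - intros τ' t q Ht Hq Lp Lt.
    destruct (H2 τ' t q Ht Hq Lp Lt q Hq (le_refl q Hq))
      as (r & Hr & Lr & σ' & s & Hs & Ls & E).
    exists r; split; [|split]; auto; exists σ', s; split; [|split]; auto.
    now apply Eq_sym.
Qed.

(** Elements of a check name carry the condition [top P], so [p] itself serves as test condition,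
    and the induction hypothesis applies to the matching element found below it. *)
Lemma Eq_check_inj x y p : p ∈ car P -> Eq P (check P x) (check P y) p -> x = y.
Proof.
  revert y p; induction x as [x IH] using (well_founded_ind mem_wf).
  intros y p Hp [H1 H2]; apply V_ext; intro z; split; intro Hz.
  - destruct (H1 (check P z) (top P) p) as (r & Hr & _ & τ' & t & Ht & _ & E);
      auto using le_refl, le_top; [apply mem_check; eauto|].
    apply mem_check in Ht as (w & Hw & Ew); apply opair_inj in Ew as [-> _].
    now rewrite (IH z Hz w r Hr E).
  - destruct (H2 (check P z) (top P) p) as (r & Hr & _ & τ' & t & Ht & _ & E);
      auto using le_refl, le_top; [apply mem_check; eauto|].
    apply mem_check in Ht as (w & Hw & Ew); apply opair_inj in Ew as [-> _].
    now rewrite <- (IH w Hw z r Hr E).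
Qed.

(** * Separativity and maximal antichains *)

Lemma separative_le p q : separative P -> p ∈ car P -> q ∈ car P ->
  dense_below P p (fun r => le P r q) -> le P p q.
Proof.
  intros S Hp Hq H; apply NNPP; intro N.
  destruct (S p q Hp Hq N) as (r & Hr & Lr & I).
  destruct (H r Hr Lr) as (s & Hs & Ls & K); apply I; now exists s.
Qed.

(** Zorn's lemma gives an antichain maximal among those contained in [D]; the density of [D] makes
    it maximal among all antichains. *)
Lemma exists_maximal_antichain (D : V -> Prop) :
  (forall p, p ∈ car P -> exists d, d ∈ car P /\ le P d p /\ D d) ->
  exists A, maximal_antichain P A /\ forall p, p ∈ A -> D p.
Proof.
  intro HD.
  pose (anti := fun X : V -> Prop => (forall p, X p -> p ∈ car P /\ D p) /\
    forall p q, X p -> X q -> p <> q -> ~ compatible P p q).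
  destruct (@classical_sets.Zorn_bigcup V anti) as (X & [X1 X2] & Xmax).
  { intros F HF Htot; split.
    - intros p [Y FY Yp]; exact (proj1 (HF Y FY) p Yp).
    - intros p q [Y FY Yp] [Z FZ Zq].
      destruct (Htot Y Z FY FZ) as [L|L].
      + apply (proj2 (HF Z FZ)); [apply L, Yp | exact Zq].
      + apply (proj2 (HF Y FY)); [exact Yp | apply L, Zq]. }
  (* Zorn was applied to predicates; as a subclass of [car P], the maximal one is a set. *)
  assert (SX : small X).
  { apply small_sub with (1 := small_mem (car P)); apply X1. }
  assert (AE := mem_setof X SX).
  exists (setof X); split; [split; [|split]|].
  - intros p Hp; apply AE in Hp; apply X1, Hp.
  - intros p q Hp Hq; apply AE in Hp, Hq; auto.
  - intros p Hp; apply NNPP; intro N.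
    destruct (HD p Hp) as (d & Hd & Ld & Dd).
    assert (I : forall x, X x -> ~ compatible P d x).
    { intros x Hx (r & Hr & L1 & L2); apply N; exists x.
      split; [now apply AE|]; exists r; eauto using le_trans. }
    (* If [p] were incompatible with all of [X], then [d] below [p] could be added to [X]. *)
    apply (Xmax (fun x => X x \/ x = d)); [split|split].
    + intros x Hx; now left.
    + intros K; apply (I d); [apply K; now right|].
      exists d; auto using le_refl.
    + intros x [Hx| ->]; auto.
    + intros x y [Hx| ->] [Hy| ->] Ne; auto; try congruence.
      intros (r & H1 & H2 & H3); apply (I x Hx); now exists r.
  - intros p Hp; apply AE in Hp; apply X1, Hp.
Qed.

End Forcing.

(** * Iterations *)

Section Iteration.
Context {γ : V} {P : V -> poset} {Q : V -> poset_name} (hiter : is_iteration γ P Q).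

Lemma iter_notion_top : forcing_notion (P γ).
Proof. apply (iter_notion _ _ _ hiter); now right. Qed.

Lemma iter_notion_mem β : β ∈ γ -> forcing_notion (P β).
Proof. intro H; apply (iter_notion _ _ _ hiter); now left. Qed.

Lemma restrict_mem β p : β ∈ γ -> p ∈ car (P γ) -> restrict p β ∈ car (P β).
Proof. intros Hβ Hp; apply (iter_restrict _ _ _ hiter) with γ; unfold ole; auto. Qed.

Lemma le_restrict β p q : β ∈ γ -> p ∈ car (P γ) -> q ∈ car (P γ) ->
  le (P γ) q p -> le (P β) (restrict q β) (restrict p β).
Proof.
  intros Hβ Hp Hq L.
  exact (proj1 (proj1 (iter_le _ _ _ hiter γ p q (or_intror eq_refl) Hp Hq) L β Hβ)).
Qed.

Lemma forces_coord_le β p q : β ∈ γ -> p ∈ car (P γ) -> q ∈ car (P γ) ->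
  le (P γ) q p -> forces (restrict q β) (Le (P β) (Q β) (app q β) (app p β)).
Proof.
  intros Hβ Hp Hq L.
  exact (proj2 (proj1 (iter_le _ _ _ hiter γ p q (or_intror eq_refl) Hp Hq) L β Hβ)).
Qed.

(** Induction on the stage [α]: at each [β], [iter_le] asks for the comparison of restrictions,
    which is the induction hypothesis and may thus be assumed in the last premise, and for a
    coordinate, read off from stage [δ] if [β ∈ δ] and given by that premise otherwise. *)
Lemma le_of_coords δ p q : δ ∈ γ -> p ∈ car (P γ) -> q ∈ car (P γ) ->
  le (P δ) (restrict q δ) (restrict p δ) ->
  (forall β, β ∈ γ -> β ∉ δ -> le (P β) (restrict q β) (restrict p β) ->
     forces (restrict q β) (Le (P β) (Q β) (app q β) (app p β))) ->
  le (P γ) q p.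
Proof.
  intros Hδ Hp Hq L H.
  assert (hγ := iter_length _ _ _ hiter).
  assert (T : forall α β, ole α γ -> β ∈ α -> β ∈ γ /\ forall ξ, ξ ∈ β -> ξ ∈ α).
  { intros α β [Hα| ->] Hβ; split; auto; try (intros ξ Hξ).
    - exact (proj1 hγ _ _ Hα Hβ).
    - exact (ordinal_mem_trans _ _ _ _ hγ Hα Hβ Hξ).
    - exact (proj1 hγ _ _ Hβ Hξ). }
  assert (C : forall α r, ole α γ -> r ∈ car (P γ) -> restrict r α ∈ car (P α)).
  { intros α r Hα Hr; apply (iter_restrict _ _ _ hiter) with γ; auto; now right. }
  assert (K : forall α, ole α γ -> le (P α) (restrict q α) (restrict p α)).
  { intro α; induction α as [α IH] using (well_founded_ind mem_wf); intro Hα.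
    apply (iter_le _ _ _ hiter); auto; intros β Hβ.
    destruct (T α β Hα Hβ) as [Hβγ Hsub].
    rewrite !restrict_restrict, !app_restrict by auto.
    assert (Lβ : le (P β) (restrict q β) (restrict p β)) by (apply IH; unfold ole; auto).
    split; [exact Lβ|]; destruct (classic (β ∈ δ)) as [Hβδ|Hβδ]; [|now apply H].
    assert (oδ : ole δ γ) by now left.
    assert (F := proj2 (proj1 (iter_le _ _ _ hiter δ _ _ oδ (C δ p oδ Hp) (C δ q oδ Hq))
      L β Hβδ)).
    rewrite !app_restrict, restrict_restrict in F; auto.
    apply T with (1 := oδ), Hβδ. }
  specialize (K γ (or_intror eq_refl)).
  rewrite !restrict_full in K; [exact K|..];
    apply (iter_cond _ _ _ hiter γ); auto; now right.
Qed.

(** * Replacing the first [δ] coordinates of a condition; names lifted from stage [δ] *)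

Section Graft.
Context {δ : V} (Hδ : δ ∈ γ).

Local Notation graft s p := (union s (tail γ δ p)).

Lemma graft_mem s p : s ∈ car (P δ) -> p ∈ car (P γ) ->
  le (P δ) s (restrict p δ) -> graft s p ∈ car (P γ).
Proof. intros; apply (iter_amalgam _ _ _ hiter); auto; now right. Qed.

Lemma restrict_graft s p : s ∈ car (P δ) -> restrict (graft s p) δ = s.
Proof.
  intro Hs; apply restrict_union_tail.
  apply (iter_cond _ _ _ hiter δ s); auto; now left.
Qed.

Lemma app_graft s p β : s ∈ car (P δ) -> β ∈ γ -> β ∉ δ ->
  app (graft s p) β = app p β.
Proof.
  intro Hs; apply app_union_tail.
  apply (iter_cond _ _ _ hiter δ s); auto; now left.
Qed.

Lemma graft_le s u p : s ∈ car (P δ) -> u ∈ car (P γ) -> p ∈ car (P γ) ->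
  le (P δ) s (restrict u δ) -> le (P γ) u p -> le (P γ) (graft s u) p.
Proof.
  intros Hs Hu Hp Ls L; assert (Hg := graft_mem s u Hs Hu Ls).
  apply (le_trans iter_notion_top) with u; auto.
  apply le_of_coords with δ; auto; [now rewrite restrict_graft|].
  intros β Hβ Hβδ Lβ; rewrite app_graft by auto.
  (* Outside [δ] both coordinates are [app u β]. Reflexivity at [u] compares them over
     [restrict u β], and [Lβ] carries this down to the graft. *)
  apply (Mem_mono (iter_notion_mem β Hβ)) with (restrict u β);
    auto using restrict_mem.
  apply forces_coord_le; auto; now apply (le_refl iter_notion_top).
Qed.

Lemma le_graft s u p : s ∈ car (P δ) -> u ∈ car (P γ) -> p ∈ car (P γ) ->
  graft s p ∈ car (P γ) ->
  le (P δ) (restrict u δ) s -> le (P γ) u p -> le (P γ) u (graft s p).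
Proof.
  intros Hs Hu Hp Hg Ls L; apply le_of_coords with δ; auto; [now rewrite restrict_graft|].
  intros β Hβ Hβδ _; rewrite app_graft by auto; now apply forces_coord_le.
Qed.

(** The graft forgets the first [δ] coordinates of [p], so these are compared by a separate
    hypothesis. *)
Lemma le_of_le_graft s u p : s ∈ car (P δ) -> u ∈ car (P γ) -> p ∈ car (P γ) ->
  graft s p ∈ car (P γ) ->
  le (P δ) (restrict u δ) (restrict p δ) -> le (P γ) u (graft s p) -> le (P γ) u p.
Proof.
  intros Hs Hu Hp Hg Ls L; apply le_of_coords with δ; auto.
  intros β Hβ Hβδ _; rewrite <- (app_graft s p β) by auto; now apply forces_coord_le.
Qed.

(** All conditions with the same restriction to [δ] carry [τ] in the lift. The witness [t] is the
    weakest kind of these: [restrict s δ] continued by the tail of [top (P γ)]. *)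
Lemma lift_weaken σ τ s : opair τ s ∈ lift P γ δ σ ->
  s ∈ car (P γ) /\ exists t, t ∈ car (P γ) /\ opair τ t ∈ lift P γ δ σ /\
    forall u, u ∈ car (P γ) -> le (P δ) (restrict u δ) (restrict s δ) -> le (P γ) u t.
Proof.
  intro H; apply mem_lift in H as (τ' & s' & Hs & H & E).
  apply opair_inj in E as [-> <-]; split; [exact Hs|].
  assert (Ht := top_mem iter_notion_top).
  assert (Hr := restrict_mem δ s Hδ Hs).
  assert (Hg : graft (restrict s δ) (top (P γ)) ∈ car (P γ)).
  { apply graft_mem; auto; apply le_restrict; auto; now apply (le_top iter_notion_top). }
  exists (graft (restrict s δ) (top (P γ))); split; [exact Hg|]; split.
  - apply mem_lift; exists τ', (graft (restrict s δ) (top (P γ))).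
    rewrite restrict_graft; auto.
  - intros u Hu L; apply le_graft; auto; now apply (le_top iter_notion_top).
Qed.

(** Given [q] below [p'], the first [δ] coordinates of [q] are grafted onto [p], density below [p]
    gives [r], and those of [r] are grafted back onto [q]. Abstracting over [φ] lets the induction
    for equality and the lemma on membership share this argument. *)
Lemma dense_below_lift p p' σ (φ : V -> statement) :
  p ∈ car (P γ) -> p' ∈ car (P γ) ->
  le (P δ) (restrict p' δ) (restrict p δ) ->
  (forall τ r r', in_dom τ σ -> r ∈ car (P γ) -> r' ∈ car (P γ) ->
     le (P δ) (restrict r' δ) (restrict r δ) ->
     φ (lift P γ δ τ) r -> φ (lift P γ δ τ) r') ->
  dense_below (P γ) p (fun r => exists τ t,
     opair τ t ∈ lift P γ δ σ /\ le (P γ) r t /\ φ τ r) ->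
  dense_below (P γ) p' (fun r => exists τ t,
     opair τ t ∈ lift P γ δ σ /\ le (P γ) r t /\ φ τ r).
Proof.
  intros Hp Hp' L Hφ H q Hq Lq.
  assert (HPδ := iter_notion_mem δ Hδ).
  assert (Hqδ := restrict_mem δ q Hδ Hq).
  assert (Lqp : le (P δ) (restrict q δ) (restrict p δ)).
  { apply (le_trans HPδ) with (restrict p' δ); auto using restrict_mem, le_restrict. }
  assert (Hg := graft_mem _ p Hqδ Hp Lqp).
  destruct (H (graft (restrict q δ) p) Hg) as (r & Hr & Lr & τ & t & Ht & Lt & K).
  { apply graft_le; auto; now apply (le_refl iter_notion_top). }
  assert (Hrδ := restrict_mem δ r Hδ Hr).
  assert (Lrq : le (P δ) (restrict r δ) (restrict q δ)).
  { rewrite <- (restrict_graft (restrict q δ) p) by auto; now apply le_restrict. }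
  assert (Hg' := graft_mem _ q Hrδ Hq Lrq).
  exists (graft (restrict r δ) q); split; [exact Hg'|]; split.
  { apply graft_le; auto; now apply (le_refl iter_notion_top). }
  (* The graft need not lie below [t], which may restrict later coordinates; the weakened [t']
     removes this obstacle. *)
  destruct (lift_weaken _ _ _ Ht) as (Ct & t' & Ct' & Ht' & Lt').
  exists τ, t'; split; [exact Ht'|]; split.
  - apply Lt'; auto; rewrite restrict_graft by auto; now apply le_restrict.
  - apply mem_lift in Ht as (τ' & s & _ & Hs & E); apply opair_inj in E as [-> _].
    apply Hφ with r; auto; [now eexists; eauto|].
    rewrite restrict_graft by auto; now apply (le_refl HPδ).
Qed.

(** Equality of lifted names holds in the extension by the restricted generic
    filter, so only the first [δ] coordinates of a condition matter. *)
Lemma Eq_lift σ τ p p' : p ∈ car (P γ) -> p' ∈ car (P γ) ->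
  le (P δ) (restrict p' δ) (restrict p δ) ->
  Eq (P γ) (lift P γ δ σ) (lift P γ δ τ) p -> Eq (P γ) (lift P γ δ σ) (lift P γ δ τ) p'.
Proof.
  assert (HPδ := iter_notion_mem δ Hδ); assert (HPγ := iter_notion_top).
  revert τ p p'; induction σ as [σ IH] using (well_founded_ind in_dom_wf).
  intros τ p p' Hp Hp' L E.
  (* A test condition [q] below [p'] is traded for [u] below [p], where [E] is available, without
     changing its first [δ] coordinates. *)
  assert (K : forall ρ ρ' s q, opair ρ' s ∈ lift P γ δ ρ -> q ∈ car (P γ) ->
    le (P γ) q p' -> le (P γ) q s ->
    exists u, u ∈ car (P γ) /\ le (P γ) u p /\ restrict u δ = restrict q δ /\
      Mem (P γ) ρ' (lift P γ δ ρ) u).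
  { intros ρ ρ' s q Hs Hq Lq Lqs.
    assert (Hqδ := restrict_mem δ q Hδ Hq).
    assert (Lqp : le (P δ) (restrict q δ) (restrict p δ)).
    { apply (le_trans HPδ) with (restrict p' δ); auto using restrict_mem, le_restrict. }
    assert (Hg := graft_mem _ p Hqδ Hp Lqp).
    destruct (lift_weaken _ _ _ Hs) as (Cs & t & Ct & Ht & Lt).
    exists (graft (restrict q δ) p); split; [exact Hg|].
    split; [apply graft_le; auto; now apply (le_refl HPγ)|].
    split; [now apply restrict_graft|].
    apply (Mem_intro HPγ) with t; auto.
    apply Lt; auto; rewrite restrict_graft by auto; now apply le_restrict. }
  apply (Eq_intro HPγ).
  - intros σ' s q Hs Hq Lq Lqs.
    destruct (K σ σ' s q Hs Hq Lq Lqs) as (u & Hu & Lu & Eu & Mu).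
    apply (Mem_eq_r HPγ) with (τ' := lift P γ δ τ) in Mu; [|exact Hu|].
    2: now apply (Eq_mono HPγ) with p.
    apply mem_lift in Hs as (ρ & v & _ & Hv & Eρ); apply opair_inj in Eρ as [-> _].
    (* Since [u] and [q] agree up to [δ], membership moves back from [u] to [q]. *)
    apply (dense_below_lift u q τ (Eq (P γ) (lift P γ δ ρ))); auto.
    + rewrite Eu; apply (le_refl HPδ); now apply restrict_mem.
    + intros τ' r r' _ Hr Hr' Lr; apply IH; auto; now exists (restrict v δ).
  - intros τ' s q Hs Hq Lq Lqs.
    destruct (K τ τ' s q Hs Hq Lq Lqs) as (u & Hu & Lu & Eu & Mu).
    apply (Mem_eq_r HPγ) with (τ' := lift P γ δ σ) in Mu; [|exact Hu|].
    2: now apply (Eq_sym (P := P γ)), (Eq_mono HPγ) with p.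
    apply mem_lift in Hs as (ρ & v & _ & Hv & Eρ); apply opair_inj in Eρ as [-> _].
    apply (dense_below_lift u q σ (Eq (P γ) (lift P γ δ ρ))); auto.
    + rewrite Eu; apply (le_refl HPδ); now apply restrict_mem.
    + intros σ' r r' Hσ' Hr Hr' Lr F; apply Eq_sym, IH with r; auto; now apply Eq_sym.
Qed.

Lemma Mem_lift σ τ p p' : p ∈ car (P γ) -> p' ∈ car (P γ) ->
  le (P δ) (restrict p' δ) (restrict p δ) ->
  Mem (P γ) (lift P γ δ σ) (lift P γ δ τ) p -> Mem (P γ) (lift P γ δ σ) (lift P γ δ τ) p'.
Proof.
  intros Hp Hp' L; apply dense_below_lift with (φ := Eq (P γ) (lift P γ δ σ)); auto.
  intros ρ r r' _; apply Eq_lift.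
Qed.

(** [lift P γ δ (check (P δ) x)] would not do: only conditions restricting to
    exactly [top (P δ)] enter it, and there may be none in [P γ]. *)
Lemma exists_lift_check x : exists σ, is_name (P δ) σ /\
  forall p, p ∈ car (P γ) -> Eq (P γ) (lift P γ δ σ) (check (P γ) x) p.
Proof.
  assert (HPδ := iter_notion_mem δ Hδ); assert (HPγ := iter_notion_top).
  induction x as [x IH] using (well_founded_ind mem_wf).
  pose (R := fun y σ => is_name (P δ) σ /\
    forall p, p ∈ car (P γ) -> Eq (P γ) (lift P γ δ σ) (check (P γ) y) p).
  pose (n := fun y => epsilon (inhabits V0) (R y)).
  assert (Hn : forall y, y ∈ x -> R y (n y)).
  { intros y Hy; apply epsilon_spec, IH, Hy. }
  (* Each element is attached to every condition of [P δ], so any [q] of [P γ] puts it into the lift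
     through [restrict q δ]. *)
  assert (Hσ := mem_setof (fun z => exists y, y ∈ x /\
     exists s, s ∈ car (P δ) /\ z = opair (n y) s)).
  match goal with |- exists σ, _ => match type of Hσ with small ?F -> _ =>
    assert (HF : small F); [|specialize (Hσ HF); exists (setof F);
      set (σ := setof F) in *; clearbody σ] end end.
  { apply small_bigcup with (Φ := fun y => y ∈ x); [apply small_mem|]; intros y _.
    apply small_image with (Φ := fun s => s ∈ car (P δ)), small_mem. }
  split.
  - constructor; intros z Hz; apply Hσ in Hz as (y & Hy & s & Hs & ->).
    exists (n y), s; split; [reflexivity|]; split; [apply Hn, Hy | exact Hs].
  - intros p Hp; apply (Eq_intro HPγ).
    + intros σ' s q Hs Hq Lp Ls.
      apply mem_lift in Hs as (ρ & t & Ht & Hρ & E); apply opair_inj in E as [-> ->].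
      apply Hσ in Hρ as (y & Hy & u & Hu & E); apply opair_inj in E as [-> _].
      apply (Mem_eq_l HPγ) with (check (P γ) y); auto.
      { apply Eq_sym, Hn; auto. }
      apply (Mem_intro HPγ) with (top (P γ)); [exact Hq | exact (top_mem HPγ) | |].
      * apply mem_check; eauto.
      * exact (le_top HPγ q Hq).
    + intros τ' s q Hs Hq Lp Ls.
      apply mem_check in Hs as (y & Hy & E); apply opair_inj in E as [-> ->].
      apply (Mem_eq_l HPγ) with (lift P γ δ (n y)); auto; [apply Hn; auto|].
      apply (Mem_intro HPγ) with q; [exact Hq | exact Hq | | exact (le_refl HPγ q Hq)].
      apply mem_lift; exists (n y), q; split; [exact Hq|]; split; [|reflexivity].
      apply Hσ; exists y; split; [exact Hy|]; eexists; split; [|reflexivity].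
      now apply restrict_mem.
Qed.

(** The check name is exchanged for a lifted name of the same set, which reduces the claim to
    [Mem_lift]. *)
Lemma check_lift_mono x c p p' : p ∈ car (P γ) -> p' ∈ car (P γ) ->
  le (P δ) (restrict p' δ) (restrict p δ) ->
  Mem (P γ) (check (P γ) x) (lift P γ δ c) p ->
  Mem (P γ) (check (P γ) x) (lift P γ δ c) p'.
Proof.
  intros Hp Hp' L H; assert (HPγ := iter_notion_top).
  destruct (exists_lift_check x) as (σ & _ & Eσ).
  apply (Mem_eq_l HPγ) with (lift P γ δ σ); auto.
  apply Mem_lift with p; auto.
  apply (Mem_eq_l HPγ) with (check (P γ) x); auto.
  apply Eq_sym; auto.
Qed.

End Graft.
End Iteration.

(** * Finality and pseudodistributivity *)

Section Equivalence.
Context {γ : V} {P : V -> poset} {Q : V -> poset_name} (hiter : is_iteration γ P Q).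
Let HPγ : forcing_notion (P γ) := iter_notion_top hiter.

(** The name of the function sending [a ∈ η] to the element of [A a] that lies in
    the generic filter. *)
Definition generic_choice (η : V) (A : V -> V) : V :=
  setof (fun z => exists a, a ∈ η /\ exists p, p ∈ A a /\
    z = opair (check (P γ) (opair a p)) p).

Lemma mem_generic_choice η A z : z ∈ generic_choice η A <->
  exists a, a ∈ η /\ exists p, p ∈ A a /\ z = opair (check (P γ) (opair a p)) p.
Proof.
  apply mem_setof.
  apply small_bigcup with (Φ := fun a => a ∈ η); [apply small_mem|]; intros a _.
  apply small_image with (Φ := fun p => p ∈ A a), small_mem.
Qed.

Lemma generic_choice_spec η A x u : u ∈ car (P γ) ->
  (forall a, a ∈ η -> maximal_antichain (P γ) (A a)) ->
  Mem (P γ) (check (P γ) x) (generic_choice η A) u ->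
  dense_below (P γ) u (fun r => exists a p,
    a ∈ η /\ p ∈ A a /\ p ∈ car (P γ) /\ x = opair a p /\ le (P γ) r p).
Proof.
  intros Hu HA H q Hq Lq; destruct (H q Hq Lq) as (r & Hr & Lr & τ & t & Ht & Lt & E).
  apply mem_generic_choice in Ht as (a & Ha & p & Hp & Et).
  apply opair_inj in Et as [-> ->].
  apply (Eq_check_inj HPγ) in E; auto; subst x.
  exists r; split; [|split]; auto; exists a, p; repeat split; auto.
  now apply (HA a Ha).
Qed.

(** Totality comes from maximality of each [A a], uniqueness of values from the incompatibility of
    its distinct elements. *)
Lemma generic_choice_function η A :
  (forall a, a ∈ η -> maximal_antichain (P γ) (A a)) ->
  Is_ground_valued_function (P γ) η (generic_choice η A) (top (P γ)).
Proof.
  intro HA; split; [|split].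
  - intros z _ q Hq _ H q' Hq' Lq'; destruct (H q' Hq' Lq') as (r & Hr & Lr & τ & t & Ht & _ & E).
    exists r; split; [|split]; auto.
    apply mem_generic_choice in Ht as (a & Ha & p & Hp & Et).
    apply opair_inj in Et as [-> ->].
    exists a; split; [exact Ha|].
    apply (dense_below_intro HPγ); auto; intros r' Hr' Lr'.
    exists p; split; [exact I|]; rewrite check_opair; now apply (Eq_mono HPγ) with r.
  - intros a Ha q Hq _; destruct (HA a Ha) as (C & _ & M).
    destruct (M q Hq) as (p & Hp & r & Hr & L1 & L2).
    exists r; split; [|split]; auto; exists p; split; [exact I|]; rewrite check_opair.
    apply (Mem_intro HPγ) with p; auto; apply mem_generic_choice; eauto.
  - intros a Ha x _ y _ q1 Hq1 _ H1 q2 Hq2 L2 H2; rewrite check_opair in H1, H2.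
    destruct (generic_choice_spec η A _ _ Hq1 HA H1 q2 Hq2 L2)
      as (r & Hr & Lr & a1 & p1 & Ha1 & Hp1 & _ & E1 & K1).
    destruct (generic_choice_spec η A _ _ Hq2 HA H2 r Hr Lr)
      as (s & Hs & Ls & a2 & p2 & Ha2 & Hp2 & Cp2 & E2 & K2).
    apply opair_inj in E1 as [<- ->], E2 as [<- ->].
    destruct (HA a Ha) as (C & N & _).
    replace p2 with p1; [now apply (Eq_refl HPγ)|].
    apply NNPP; intro Ne; apply (N p1 p2 Hp1 Hp2 Ne); exists s.
    split; [|split]; auto; apply (le_trans HPγ) with r; auto.
Qed.

Lemma is_name_generic_choice η A :
  (forall a, a ∈ η -> maximal_antichain (P γ) (A a)) ->
  is_name (P γ) (generic_choice η A).
Proof.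
  intro HA; constructor; intros z Hz.
  apply mem_generic_choice in Hz as (a & Ha & p & Hp & ->).
  exists (check (P γ) (opair a p)), p; split; [reflexivity|]; split.
  - apply is_name_check, (top_mem HPγ).
  - now apply (HA a Ha).
Qed.

(** The condition [s] in the definition of [quotient_le] is [restrict r δ] itself; that [r] lies
    below both [q] and [p] makes both grafts conditions. *)
Lemma forces_Quotient_le δ q p r : δ ∈ γ -> q ∈ car (P γ) -> p ∈ car (P γ) ->
  r ∈ car (P γ) -> le (P γ) r q -> le (P γ) r p ->
  le (P γ) (union (restrict r δ) (tail γ δ q)) p ->
  Quotient_le P γ δ q p (restrict r δ).
Proof.
  intros Hδ Hq Hp Hr Lq Lp L.
  assert (HPδ := iter_notion_mem hiter δ Hδ).
  assert (Hrδ := restrict_mem hiter δ r Hδ Hr).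
  assert (Hgq := graft_mem hiter Hδ _ q Hrδ Hq (le_restrict hiter δ q r Hδ Hq Hr Lq)).
  assert (Hgp := graft_mem hiter Hδ _ p Hrδ Hp (le_restrict hiter δ p r Hδ Hp Hr Lp)).
  apply (Mem_intro HPδ) with (restrict r δ); auto; [|now apply (le_refl HPδ)].
  apply mem_quotient_le; exists q, p, (restrict r δ); repeat split; auto.
  apply (le_graft hiter Hδ); auto.
  rewrite (restrict_graft hiter Hδ) by auto; now apply (le_refl HPδ).
Qed.

(** Some [s] below [restrict r δ] extends a [t] over which the tail of [q] is below that of [p].
    Grafting [s] onto [r] gives a condition below [r], hence below [t] with the tail of [q], hence
    below [t] with the tail of [p]. *)
Lemma compatible_of_Quotient_le δ q p r : δ ∈ γ -> q ∈ car (P γ) -> p ∈ car (P γ) ->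
  r ∈ car (P γ) -> le (P γ) r q -> le (P δ) (restrict r δ) (restrict p δ) ->
  Quotient_le P γ δ q p (restrict r δ) ->
  exists u, u ∈ car (P γ) /\ le (P γ) u r /\ le (P γ) u p.
Proof.
  intros Hδ Hq Hp Hr Lq Lp H.
  assert (HPδ := iter_notion_mem hiter δ Hδ).
  assert (Hrδ := restrict_mem hiter δ r Hδ Hr).
  destruct (H _ Hrδ (le_refl HPδ _ Hrδ)) as (s & Hs & Ls & τ & t & Ht & Lt & E).
  apply mem_quotient_le in Ht as (q' & p' & t' & Hq' & Hp' & Ht' & Gq & Gp & L & Eτ).
  apply opair_inj in Eτ as [-> <-].
  unfold quotient_cond in E; rewrite !check_opair in E.
  apply (Eq_check_inj HPδ) in E; auto; apply opair_inj in E as [E1 E2].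
  (* The conditions [q'] and [p'] behind the pair may differ from [q] and [p], but their tails are
     the same. *)
  rewrite <- E1, <- E2 in *.
  assert (Hu := graft_mem hiter Hδ s r Hs Hr Ls).
  assert (Lu : le (P δ) (restrict (union s (tail γ δ r)) δ) s).
  { rewrite (restrict_graft hiter Hδ) by auto; now apply (le_refl HPδ). }
  exists (union s (tail γ δ r)); split; [exact Hu|]; split.
  { apply (graft_le hiter Hδ); auto; now apply (le_refl HPγ). }
  apply (le_of_le_graft hiter Hδ) with t; auto.
  { rewrite (restrict_graft hiter Hδ) by auto.
    apply (le_trans HPδ) with (restrict r δ); auto; now apply restrict_mem with (1 := hiter). }
  apply (le_trans HPγ) with (union t (tail γ δ q)); auto.
  apply (le_graft hiter Hδ); auto.
  - rewrite (restrict_graft hiter Hδ) by auto; exact Lt.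
  - now apply (graft_le hiter Hδ).
Qed.

Lemma final_pseudodistributive κ : separative (P γ) ->
  final γ P κ -> pseudodistributive γ P κ.
Proof.
  intros S F η A Hη HA.
  (* Finality makes dense the conditions that fix both a stage [δ] and a [P δ]-name for the choice
     function; [B] is drawn from them. *)
  destruct (exists_maximal_antichain HPγ (fun q => exists δ c, δ ∈ γ /\
    Eq (P γ) (generic_choice η A) (lift P γ δ c) q)) as (B & HB & BD).
  { intros p Hp.
    destruct (F η Hη (generic_choice η A) (is_name_generic_choice η A HA) (top (P γ))
      (top_mem HPγ) (le_refl HPγ _ (top_mem HPγ)) (generic_choice_function η A HA)
      p Hp (le_top HPγ p Hp)) as (r & Hr & Lr & δ & Hδ & K).
    destruct (K r Hr (le_refl HPγ r Hr)) as (s & Hs & Ls & c & _ & E).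
    exists s; split; [exact Hs|]; split; [|now exists δ, c].
    apply (le_trans HPγ) with r; auto. }
  exists B; split; [exact HB|]; intros q HqB.
  destruct (BD q HqB) as (δ & c & Hδ & E); exists δ; split; [exact Hδ|].
  intros a p r Ha Hp Hr Lrp Lrq.
  assert (HPδ := iter_notion_mem hiter δ Hδ).
  assert (Hq := proj1 HB q HqB).
  assert (Hpc : p ∈ car (P γ)) by now apply (HA a Ha).
  apply forces_Quotient_le; auto.
  assert (Hrδ := restrict_mem hiter δ r Hδ Hr).
  assert (Hg := graft_mem hiter Hδ _ q Hrδ Hq (le_restrict hiter δ q r Hδ Hq Hr Lrq)).
  assert (Lg : le (P γ) (union (restrict r δ) (tail γ δ q)) q).
  { apply (graft_le hiter Hδ); auto; [now apply (le_restrict hiter)|].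
    now apply (le_refl HPγ). }
  (* [r] forces the pair into the choice function, hence into the lift of [c]. The graft agrees with
     [r] up to [δ], so it forces the same, and being below [q] it may return to the choice
     function. *)
  assert (M : Mem (P γ) (check (P γ) (opair a p)) (generic_choice η A)
    (union (restrict r δ) (tail γ δ q))).
  { apply (Mem_eq_r HPγ) with (lift P γ δ c); auto.
    { apply Eq_sym, (Eq_mono HPγ) with q; auto. }
    apply (check_lift_mono hiter Hδ) with r; auto.
    { rewrite (restrict_graft hiter Hδ) by auto; now apply (le_refl HPδ). }
    apply (Mem_eq_r HPγ) with (generic_choice η A); auto.
    { apply (Eq_mono HPγ) with q; auto. }
    apply (Mem_intro HPγ) with p; auto; apply mem_generic_choice; eauto. }
  apply (separative_le); auto.
  intros u Hu Lu.
  destruct (generic_choice_spec η A _ _ Hg HA M u Hu Lu)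
    as (v & Hv & Lv & a' & p' & _ & _ & _ & E' & Lvp).
  apply opair_inj in E' as [_ <-]; now exists v.
Qed.

Lemma pseudodistributive_final κ : pseudodistributive γ P κ -> final γ P κ.
Proof.
  intros D η Hη b Nb p0 Hp0 _ (Fdom & Ftot & Ffun).
  pose (val := fun a x => Mem (P γ) (check (P γ) (opair a x)) b).
  pose (Dec := fun a p => ~ compatible (P γ) p p0 \/
    (le (P γ) p p0 /\ exists x, val a x p)).
  assert (HA : forall a, a ∈ η -> exists A, maximal_antichain (P γ) A /\
    forall p, p ∈ A -> Dec a p).
  { intros a Ha; apply (exists_maximal_antichain HPγ).
    intros p Hp; destruct (classic (compatible (P γ) p p0)) as [(r & Hr & L1 & L2)|N].
    - destruct (Ftot a Ha r Hr L2) as (s & Hs & Ls & x & _ & K).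
      rewrite check_opair in K; exists s; split; [exact Hs|]; split.
      + apply (le_trans HPγ) with r; auto.
      + right; split; [apply (le_trans HPγ) with r; auto | now exists x].
    - exists p; split; [exact Hp|]; split; [now apply (le_refl HPγ) | now left]. }
  pose (isA := fun a A => maximal_antichain (P γ) A /\ forall p, p ∈ A -> Dec a p).
  pose (A := fun a => epsilon (inhabits V0) (isA a)).
  assert (HAs : forall a, a ∈ η -> isA a (A a)).
  { intros a Ha; apply epsilon_spec, HA, Ha. }
  destruct (D η A Hη (fun a Ha => proj1 (HAs a Ha))) as (B & HB & HBδ).
  intros p1 Hp1 L1.
  destruct (proj2 (proj2 HB) p1 Hp1) as (q & HqB & r0 & Hr0 & L01 & L0q).
  destruct (HBδ q HqB) as (δ & Hδ & HBle).
  assert (HPδ := iter_notion_mem hiter δ Hδ).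
  assert (Hq := proj1 HB q HqB).
  exists r0; split; [exact Hr0|]; split; [exact L01|]; exists δ; split; [exact Hδ|].
  pose (F := fun a p => epsilon (inhabits V0) (fun x => val a x p)).
  (* A common extension [t] of [p] and [p0] excludes the incompatible alternative of [Dec], so
     [F a p] is a genuine value. *)
  assert (HF : forall a p t, a ∈ η -> p ∈ A a -> t ∈ car (P γ) -> le (P γ) t p ->
    le (P γ) t p0 -> p ∈ car (P γ) /\ le (P γ) p p0 /\ val a (F a p) p).
  { intros a p t Ha Hp Ht Lp L0; destruct (HAs a Ha) as [(C & _) K].
    split; [now apply C|].
    destruct (K p Hp) as [N|[L Hx]]; [exfalso; apply N; now exists t|].
    split; [exact L | exact (epsilon_spec (inhabits V0) _ Hx)]. }
  pose (n := fun x => epsilon (inhabits V0) (fun σ => is_name (P δ) σ /\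
    forall p, p ∈ car (P γ) -> Eq (P γ) (lift P γ δ σ) (check (P γ) x) p)).
  assert (Hn : forall x, is_name (P δ) (n x) /\
    forall p, p ∈ car (P γ) -> Eq (P γ) (lift P γ δ (n x)) (check (P γ) x) p).
  { intro x; apply epsilon_spec, (exists_lift_check hiter Hδ). }
  (* The [P δ]-name computing [b]: the pair of [a] and the value decided by [p] is put in by the
     restriction of every [t] below [p], [q] and [p0]. *)
  assert (Hc : exists c, forall z, z ∈ c <-> exists a, a ∈ η /\ exists p, p ∈ A a /\
    exists t, (t ∈ car (P γ) /\ le (P γ) t p /\ le (P γ) t q /\ le (P γ) t p0) /\
    z = opair (n (opair a (F a p))) (restrict t δ)).
  { apply small_bigcup with (Φ := fun a => a ∈ η); [apply small_mem|]; intros a _.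
    apply small_bigcup with (Φ := fun p => p ∈ A a); [apply small_mem|]; intros p _.
    apply small_image.
    apply small_sub with (1 := small_mem (car (P γ))); tauto. }
  destruct Hc as [c Hc].
  apply (dense_below_intro HPγ); [exact Hr0|]; intros r Hr Lr; exists c; split.
  { constructor; intros z Hz; apply Hc in Hz as (a & Ha & p & Hp & t & (Ht & _) & ->).
    exists (n (opair a (F a p))), (restrict t δ); split; [reflexivity|]; split.
    - apply Hn.
    - now apply (restrict_mem hiter). }
  assert (Lrq : le (P γ) r q) by (apply (le_trans HPγ) with r0; auto).
  assert (Lr0 : le (P γ) r p0).
  { apply (le_trans HPγ) with r0; auto; apply (le_trans HPγ) with p1; auto. }
  apply (Eq_intro HPγ).
  (* [b] is included in the lift: some [v] identifies [σ] with a pair at [a] and lies below some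
     [p ∈ A a]. Then [v] itself is a [t] as in the construction of [c]. *)
  - intros σ s r' Hs Hr' Lr' Ls.
    destruct Nb as [Nb]; destruct (Nb _ Hs) as (σ' & s' & E & Nσ & Cs).
    apply opair_inj in E as [<- <-].
    assert (L'0 : le (P γ) r' p0) by (apply (le_trans HPγ) with r; auto).
    assert (M : Mem (P γ) σ b r') by now apply (Mem_intro HPγ) with s.
    apply (dense_below_idem HPγ); intros u Hu Lu.
    destruct (Fdom σ Nσ r' Hr' L'0 M u Hu Lu) as (v1 & Hv1 & Lv1 & a & Ha & K).
    destruct (K v1 Hv1 (le_refl HPγ v1 Hv1)) as (v2 & Hv2 & Lv2 & x & _ & E).
    cbv beta in E; rewrite check_opair in E.
    destruct (HAs a Ha) as [(_ & _ & Max) _].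
    destruct (Max v2 Hv2) as (p & Hp & v & Hv & Lv & Lvp).
    assert (Lvu : le (P γ) v u).
    { apply (le_trans HPγ) with v2; auto; apply (le_trans HPγ) with v1; auto. }
    assert (Lvr' : le (P γ) v r') by (apply (le_trans HPγ) with u; auto).
    assert (Lv0 : le (P γ) v p0) by (apply (le_trans HPγ) with r'; auto).
    assert (Lvq : le (P γ) v q).
    { apply (le_trans HPγ) with r; auto; apply (le_trans HPγ) with r'; auto. }
    destruct (HF a p v Ha Hp Hv Lvp Lv0) as (Cp & Lp0 & Vp).
    assert (Ev : Eq (P γ) σ (check (P γ) (opair a x)) v) by now apply (Eq_mono HPγ) with v2.
    (* Both [x] and [F a p] are forced by [v] to be the value of [b] at [a]. *)
    assert (Ex : x = F a p).
    { apply (Eq_check_inj HPγ) with v; auto.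
      apply (Ffun a Ha x Logic.I (F a p) Logic.I v Hv Lv0) with (q := v); auto;
        try (now apply (le_refl HPγ)); rewrite check_opair.
      - apply (Mem_eq_l HPγ) with σ; auto; now apply (Mem_mono HPγ) with r'.
      - now apply (Mem_mono HPγ) with p. }
    exists v; split; [exact Hv|]; split; [exact Lvu|].
    apply (Mem_eq_l HPγ) with (lift P γ δ (n (opair a x))); auto.
    { apply (Eq_trans HPγ) with (check (P γ) (opair a x)); auto; [now apply Hn|].
      now apply Eq_sym. }
    apply (Mem_intro HPγ) with v; auto; [|now apply (le_refl HPγ)].
    apply mem_lift; exists (n (opair a x)), v; split; [exact Hv|]; split; [|reflexivity].
    apply Hc; exists a; split; [exact Ha|]; exists p; split; [exact Hp|].
    exists v; rewrite Ex; auto.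
  (* The lift is included in [b]: [restrict s δ] forces the tail of [q] below that of [p], so every
     [u] below [r'] is compatible with [p], which forces the pair into [b]. *)
  - intros τ t r' Ht Hr' Lr' Lt.
    apply mem_lift in Ht as (ρ & t' & Ht' & Hρ & E); apply opair_inj in E as [-> <-].
    apply Hc in Hρ as (a & Ha & p & Hp & s & (Hs & Lsp & Lsq & Ls0) & E).
    apply opair_inj in E as [-> Er].
    destruct (HF a p s Ha Hp Hs Lsp Ls0) as (Cp & Lp0 & Vp).
    assert (Quo := HBle a p s Ha Hp Hs Lsp Lsq).
    apply (dense_below_idem HPγ); intros u Hu Lu.
    assert (Huδ := restrict_mem hiter δ u Hδ Hu).
    assert (Lus : le (P δ) (restrict u δ) (restrict s δ)).
    { rewrite <- Er; apply (le_restrict hiter); auto; apply (le_trans HPγ) with r'; auto. }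
    destruct (compatible_of_Quotient_le δ q p u) as (v & Hv & Lvu & Lvp); auto.
    { apply (le_trans HPγ) with r; auto; apply (le_trans HPγ) with r'; auto. }
    { apply (le_trans HPδ) with (restrict s δ); auto; try now apply (restrict_mem hiter).
      now apply (le_restrict hiter). }
    { apply (Mem_mono HPδ) with (restrict s δ); auto; now apply (restrict_mem hiter). }
    exists v; split; [exact Hv|]; split; [exact Lvu|].
    apply (Mem_eq_l HPγ) with (check (P γ) (opair a (F a p))); auto.
    { apply Eq_sym; now apply Hn. }
    now apply (Mem_mono HPγ) with p.
Qed.

End Equivalence.

Theorem theorem5p3 (γ : V) (P : V -> poset) (Q : V -> poset_name) (κ : V)
    (hiter : is_iteration γ P Q) (hsep : separative (P γ)) (hκ : ordinal κ) :
  final γ P κ <-> pseudodistributive γ P κ.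
Proof.
  split.
  - now apply (final_pseudodistributive hiter).
  - apply (pseudodistributive_final hiter).
Qed.
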